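(* Let $h$ be a squarefree Weil $p$-polynomial without real roots and $L=\mathbb{Q}[x]/(h)$. Let $\Phi_b$ be a CM-type for $L$ for which $\mathcal{S}_{\Phi_b}$ is non-empty, let $S\in\mathcal{S}_{\Phi_b}$ with group of totally real units $S^*_{\mathbb{R}}$, and let $\alpha\in S^*_{\mathbb{R}}$ be the element representing the reduction map. Let $L^+$ be the set of totally positive elements of $L$, and let $G_S=S^*_{\mathbb{R}}/(S^*\cap L^+)$, which acts on the set of CM-types for $L$; let $\Phi_b\cdot G_S$ be the orbit of $\Phi_b$. Let $I$ be a fractional ideal with multiplicator ring $T=(I:I)$, and let $\mathcal{T}$ be a transversal of $T^*/\langle v\overline{v}:v\in T^*\rangle$. For a CM-type $\Phi$ of $L$ let $\mathcal{P}^\alpha_\Phi(I)$ and $\mathcal{P}^1_\Phi(I)$ be the sets defined in the context. Consider the following statements: (1) There is an inclusion $S^*_{\mathbb{R}}\subseteq T^*_{\mathbb{R}}$. (2) For every $\xi\in S^*_{\mathbb{R}}$ we have $\xi L^+\cap\mathcal{T}\neq\emptyset$. (3) There exists a bijection $\mathcal{P}^\alpha_{\Phi_b}(I)\leftrightarrow\mathcal{P}^1_{\Phi_b}(I)$. (4) For every $\Phi_d\in\Phi_b\cdot G_S$ there exists a bijection $\mathcal{P}^1_{\Phi_b}(I)\leftrightarrow\mathcal{P}^1_{\Phi_d}(I)$. (5) For every $\Phi_d\in\Phi_b\cdot G_S$ there exists a bijection $\mathcal{P}^\alpha_{\Phi_b}(I)\leftrightarrow\mathcal{P}^1_{\Phi_d}(I)$.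 Then the implications $(1)\Rightarrow(2)$, $(1)\Rightarrow(4)$, $(2)\Rightarrow(3)$, $(4)\Rightarrow(5)$ and $(5)\Rightarrow(3)$ hold.
   Context: Data. $p$ is a prime; a squarefree Weil $p$-polynomial $h$ is a squarefree monic polynomial in $\mathbb{Z}[x]$, of degree $2g$, which is the characteristic polynomial of Frobenius of an abelian variety over $\mathbb{F}_p$. $L=\mathbb{Q}[x]/(h)$ is a CM-algebra with canonical involution $x\mapsto\overline{x}$; $\pi$ is the class of $x$, $R_w=\mathbb{Z}[\pi,p/\pi]$; fractional ideals are fractional $R_w$-ideals in $L$. $(I:J)=\{x\in L:xJ\subseteq I\}$, $I^t=\{a\in L:\mathrm{Tr}_{L/\mathbb{Q}}(aI)\subseteq\mathbb{Z}\}$, $\overline{I}=\{\overline{x}:x\in I\}$. $L_{\mathbb{R}}=\{x\in L:\overline{x}=x\}$ is the totally real subalgebra; $L^+\subset L_{\mathbb{R}}$ is the set of totally positive elements; for an order $R$ in $L$, $R^*_{\mathbb{R}}=R^*\cap L_{\mathbb{R}}$. An order $S$ is Gorenstein if $S^t$ is an invertible fractional $S$-ideal. $\gamma\in L$ is totally imaginary if $\overline{\gamma}=-\gamma$ and $\Phi$-positive if $\mathrm{Im}(\varphi(\gamma))>0$ for all $\varphi\in\Phi$. CM-types. A CM-type of $L$ is a set $\Phi$ of $g$ homomorphisms $L\to\mathbb{C}$ such that $\Phi$ and its complex conjugate partition $\mathrm{Hom}(L,\mathbb{C})$. For a totally imaginary $b\in L^*$, $\Phi_b=\{\varphi:\mathrm{Im}(\varphi(b))>0\}$;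 every CM-type is of this form, with $b$ unique up to $L^+$. $G_S$ acts on CM-types by $(u,\Phi_b)\mapsto\Phi_{ub}$, so $\Phi_b\cdot G_S=\{\Phi_{ub}:u\in S^*_{\mathbb{R}}\}$. The sets. If there exists $i_0\in L^*$ with $i_0\overline{I}^t=I$, fix such $i_0$ and put $\mathcal{P}^\alpha_\Phi(I)=\{i_0u:u\in\mathcal{T},\ \alpha^{-1}i_0u\text{ totally imaginary and }\Phi\text{-positive}\}$ and $\mathcal{P}^1_\Phi(I)=\{i_0u:u\in\mathcal{T},\ i_0u\text{ totally imaginary and }\Phi\text{-positive}\}$. If no such $i_0$ exists, both are defined to be $\emptyset$ for all $\Phi$. (The quotient $T^*/\langle v\overline{v}\rangle$ is considered when $T=\overline{T}$, which holds whenever $i_0$ exists.) The set $\mathcal{S}_\Phi$. $\mathrm{AV}_h(p)$ is the category of abelian varieties over $\mathbb{F}_p$ whose Frobenius has characteristic polynomial $h$. For $A\in\mathrm{AV}_h(p)$, $i_A:L\simeq\mathrm{End}(A)\otimes\mathbb{Q}$ sends $\pi$ to the Frobenius of $A$, and $\mathrm{End}(A)$ is viewed in $L$. Fix $\overline{\mathbb{Q}}_p\simeq\mathbb{C}$. $\mathcal{S}_\Phi$ is the set of Gorenstein orders $S$ in $L$ with $\overline{S}=S$ for which there is $A_0\in\mathrm{AV}_h(p)$ with $\mathrm{End}(A_0)=S$ admitting a canonical lifting $A$ over a $p$-adic field $K$ (residue field $\mathbb{F}_p$), i.e. the generic fibre of an abelian scheme $\mathcal{A}$ over the ring of integers of $K$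 with special fibre $A_0$ and $\mathrm{End}(\mathcal{A})=\mathrm{End}(A_0)$ via reduction, such that $A$ has CM by $L$ through $\Phi$ ($L$ acts on $\mathrm{Lie}(A)$ over $\overline{K}$ through $\Phi$). The element $\alpha$. Fix $A_w\in\mathrm{AV}_h(p)$ with $\mathrm{End}(A_w)=R_w$ and, for each $B\in\mathrm{AV}_h(p)$, an $L$-basis $\lambda_B$ of $\mathrm{Hom}(B,A_w)\otimes\mathbb{Q}$; $\mathcal{G}(B)$ is the fractional ideal with $\mathrm{Hom}(B,A_w)=\lambda_B\circ i_B(\mathcal{G}(B))$ and, for $f:B\to C$, $\mathcal{G}(f)\in L$ satisfies $\lambda_C\circ f=\lambda_B\circ i_B(\mathcal{G}(f))$. Since $S\in\mathcal{S}_{\Phi_b}$, fix an abelian variety $A_0\in\mathrm{AV}_h(p)$ with $\mathrm{End}(A_0)=S$ and a canonical lifting $A$ of $A_0$ over a $p$-adic field $K$ with residue field $\mathbb{F}_p$, such that $A$ has CM by $L$ through $\Phi_b$; write $A(\mathbb{C})\simeq\mathbb{C}^g/\Phi_b(I')$, $A^\vee(\mathbb{C})\simeq\mathbb{C}^g/\Phi_b(\overline{I'}^t)$, and for $f\in\mathrm{Hom}(A,A^\vee)$ let $\mathcal{H}(f)\in(\overline{I'}^t:I')$ be the element by which $f$ acts. The choices are normalized so that $\mathcal{G}(B^\vee)=\overline{\mathcal{G}(B)}^t$ for all $B$; $\mathcal{G}(\mathrm{Hom}(A_0,A_0^\vee))=(\overline{I'}^t:I')$; $\mathcal{G}(f^\vee)=\overline{\mathcal{G}(f)}$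 for all $f$; and the canonical isomorphism $B\to B^{\vee\vee}$ is sent by $\mathcal{G}$ to $-1$. Then $\alpha\in S^*_{\mathbb{R}}$ is the unit with $\mathcal{G}(f\bmod p)=\alpha\,\mathcal{H}(f)$ for all $f\in\mathrm{Hom}(A,A^\vee)$. *)

(* Defs.v *)
From HB Require Import structures.
From mathcomp Require Import all_boot all_order all_algebra.
From mathcomp Require Import all_classical reals.
From mathcomp Require Import complex.

Set Implicit Arguments.
Unset Strict Implicit.
Unset Printing Implicit Defensive.

Import Order.TTheory GRing.Theory Num.Theory.

Local Open Scope classical_set_scope.
Local Open Scope card_scope.
Local Open Scope ring_scope.

(* Here L = Q[x]/(h): [{poly %/ q}] is Q[x]/(q) for q monic of positive
   degree, which holds for every h considered below; pi, the class of x, is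
   ['qX]. *)
Notation Lalg h := {poly %/ map_poly (intr : int -> rat) h}.

Definition squarefree_poly (h : {poly int}) : Prop :=
  forall q r : {poly int}, h = q ^+ 2 * r -> q \is a GRing.unit.

Section Algebra.
Variables (p : nat) (h : {poly int}).
Local Notation L := (Lalg h).
Implicit Types (S I J A : set L) (x y u v : L).

(* The canonical involution of L sends f(pi) to f(p/pi). *)
Definition bar x : L :=
  horner_alg (p%:R / 'qX : L) (x : {poly rat}).

(* The trace of multiplication by x in the power basis 1, pi, pi^2, ... *)
Definition TrL x : rat :=
  \tr (\matrix_(i < (size h).-1, j < (size h).-1)
         ((x * 'qX ^+ i : L) : {poly rat})`_j).

Definition colon I J : set L := [set x | forall y, J y -> I (x * y)].

Definition tdual I : set L :=
  [set a | forall x, I x -> TrL (a * x) \is a Num.int].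

Definition barS I : set L := bar @` I.

Definition subring A : Prop :=
  [/\ A 1, forall x y, A x -> A y -> A (x - y)
    & forall x y, A x -> A y -> A (x * y)].

Definition Rw : set L :=
  [set x | forall A, subring A -> A 'qX -> A (p%:R / 'qX) -> A x].

Definition is_order S : Prop :=
  [/\ subring S,
      exists n (s : n.-tuple L), S = [set x | inIntSpan s x]
    & forall x, exists2 n : nat, (0 < n)%N & S (x *+ n)].

Definition spanS S n (s : 'I_n -> L) : set L :=
  [set x | exists2 c : 'I_n -> L, (forall i, S (c i))
                                 & x = \sum_i c i * s i].

Definition fractional_ideal S I : Prop :=
  (exists n (s : 'I_n -> L), I = spanS S s) /\
  (exists2 x, I x & x \is a GRing.unit).

Definition idealM I J : set L :=
  [set x | exists n (a c : 'I_n -> L),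
     (forall i, I (a i) /\ J (c i)) /\ x = \sum_i a i * c i].

Definition invertible_ideal S I : Prop :=
  fractional_ideal S I /\
  exists2 J, fractional_ideal S J & idealM I J = S.

Definition Gorenstein S : Prop := invertible_ideal S (tdual S).

Definition unitsS S : set L :=
  [set x | [/\ x \is a GRing.unit, S x & S x^-1]].

Definition LR : set L := [set x | bar x = x].

Definition unitsR S : set L := unitsS S `&` LR.

Definition totally_imaginary x : Prop := bar x = - x.

(* The subgroup of L^* generated by the v * bar v, for v in T^*. *)
Definition normgrp T : set L :=
  [set x | forall H : set L, H 1 ->
     (forall y z, H y -> H z -> H (y / z)) ->
     (forall v, unitsS T v -> H (v * bar v)) -> H x].

(* For T = bar T, [normgrp T] is contained in T^*, and this says that Tr is a
   transversal of T^* / <v * bar v>; in general it is one for the classes of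
   T^* modulo the subgroup <v * bar v> of L^*. *)
Definition unit_transversal T (Tr : set L) : Prop :=
  Tr `<=` unitsS T /\
  forall x, unitsS T x -> exists! u, Tr u /\ normgrp T (x / u).

Definition autodual I (i0 : L) : Prop :=
  i0 \is a GRing.unit /\ [set i0 * x | x in tdual (barS I)] = I.

Variable R : realType.
Local Notation C := (R[i]).
Local Notation HomLC := {rmorphism L -> C}.
Implicit Types Phi Psi : set HomLC.

Definition Lplus : set L :=
  [set x | LR x /\ forall f : HomLC, 0 < f x].

Definition is_CMtype (g : nat) Phi : Prop :=
  let cPhi := [set (Num.conj \o f : HomLC) | f in Phi] in
  [/\ Phi #= `I_g, Phi `|` cPhi = setT & Phi `&` cPhi = set0].

Definition Phi_of (b : L) : set HomLC := [set f | 0 < complex.Im (f b)].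

Definition positive Phi x : Prop := forall f, Phi f -> 0 < complex.Im (f x).

(* The action (u, Phi_c) |-> Phi_{u c}; it factors through
   G_S = S_R^* / (S^* /\ L^+). *)
Definition CM_orbit S Phi : set (set HomLC) :=
  [set Psi | exists u c,
     [/\ unitsR S u, c \is a GRing.unit, totally_imaginary c,
         Phi = Phi_of c & Psi = Phi_of (u * c)]].

(* P_Phi^alpha(I), and P_Phi^1(I) for alpha = 1; i0 is the chosen element, used
   only when some i with i * (bar I)^t = I exists. *)
Definition Pset (Tr : set L) (i0 alpha : L) Phi I : set L :=
  [set x | (exists i, autodual I i) /\
           exists u, [/\ Tr u, x = i0 * u,
                         totally_imaginary (alpha^-1 * x)
                       & positive Phi (alpha^-1 * x)]].

End Algebra.

Arguments Phi_of {h} R b.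
Arguments Lplus p {h} R.

Definition in_bijection (T : Type) (A B : set T) : Prop :=
  exists f : T -> T, set_bij A B f.

(* Abelian varieties and abelian schemes are not constructed: they enter through
   the structures [avCategory], [avFp] and [avLifts], which record the objects,
   the operations and their standard properties, so that a statement about
   these structures applies in particular to the actual geometric objects.
   [avCategory] is a category of abelian schemes over a fixed base, with duality:
   [homQ A B] stands for Hom(A,B) (x) Q, and [isHom] for the lattice Hom(A,B)
   inside it (Hom(A,B) is torsion-free). *)
Record avCategory := AvCategory {
  av_obj :> Type;
  homQ : av_obj -> av_obj -> lmodType rat;
  isHom : forall A B, set (homQ A B);
  idm : forall A, homQ A A;
  compm : forall A B D, homQ B D -> homQ A B -> homQ A D;
  dual : av_obj -> av_obj;
  dualm : forall A B, homQ A B -> homQ (dual B) (dual A);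
  bidual : forall A, homQ A (dual (dual A));

  compA : forall A B D E (f : homQ D E) (k : homQ B D) (l : homQ A B),
    compm f (compm k l) = compm (compm f k) l;
  comp1m : forall A B (f : homQ A B), compm (idm B) f = f;
  compm1 : forall A B (f : homQ A B), compm f (idm A) = f;
  comp_linearr : forall A B D (f : homQ B D), linear (@compm A B D f);
  comp_linearl : forall A B D (f : homQ A B), linear ((@compm A B D)^~ f);

  isHom_fg : forall A B, exists n (s : n.-tuple (homQ A B)),
    @isHom A B = [set f | inIntSpan s f];
  isHom_full : forall A B (f : homQ A B),
    exists2 n : nat, (0 < n)%N & isHom (f *+ n);
  isHom_id : forall A, isHom (idm A);
  isHom_comp : forall A B D (f : homQ B D) (k : homQ A B),
    isHom f -> isHom k -> isHom (compm f k);
  isHom_dual : forall A B (f : homQ A B), isHom f -> isHom (dualm f);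
  isHom_bidual : forall A, isHom (bidual A);

  dualm_linear : forall A B, linear (@dualm A B);
  dualm_id : forall A, dualm (idm A) = idm (dual A);
  dualm_comp : forall A B D (f : homQ B D) (k : homQ A B),
    dualm (compm f k) = compm (dualm k) (dualm f);
  bidual_nat : forall A B (f : homQ A B),
    compm (dualm (dualm f)) (bidual A) = compm (bidual B) f;
  bidual_iso : forall A, exists f, [/\ isHom f,
    compm f (bidual A) = idm A & compm (bidual A) f = idm _];
  bidual_triangle : forall A,
    compm (dualm (bidual A)) (bidual (dual A)) = idm (dual A)
}.

Arguments isHom {a A B}.
Arguments idm {a}.
Arguments compm {a A B D}.
Arguments dual {a}.
Arguments dualm {a A B}.
Arguments bidual {a}.

(* Abelian varieties over F_p; [frob] is the Frobenius endomorphism and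
   [frobPoly] its characteristic polynomial. *)
Record avFp (R : realType) (p : nat) := AvFp {
  avFp_cat :> avCategory;
  avdim : avFp_cat -> nat;
  frob : forall A : avFp_cat, homQ A A;
  frobPoly : avFp_cat -> {poly int};

  isHom_frob : forall A, isHom (frob A);
  frob_nat : forall (A B : avFp_cat) (f : homQ A B),
    compm (frob B) f = compm f (frob A);
  frob_dual : forall A : avFp_cat,
    compm (frob (dual A)) (dualm (frob A)) = p%:R *: idm (dual A);
  frobPoly_monic : forall A, frobPoly A \is monic;
  size_frobPoly : forall A, size (frobPoly A) = (2 * avdim A).+1;
  frobPoly_frob : forall A,
    \sum_(i < size (frobPoly A))
      ((frobPoly A)`_i)%:~R *: iter i (compm (frob A)) (idm A) = 0;
  frobPoly_isog : forall (A B : avFp_cat) (f : homQ A B) (k : homQ B A),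
    compm k f = idm A -> compm f k = idm B -> frobPoly A = frobPoly B;
  frobPoly_dual : forall A, frobPoly (dual A) = frobPoly A;
  (* Weil: the roots have absolute value sqrt p *)
  frobPoly_weil : forall A (z : R[i]),
    root (map_poly intr (frobPoly A)) z -> z * z^* = p%:R
}.

Arguments avdim {R p a}.
Arguments frob {R p a}.
Arguments frobPoly {R p a}.

Definition weil_polynomial (R : realType) (p : nat) (V : avFp R p)
    (h : {poly int}) (g : nat) : Prop :=
  (0 < g)%N /\ exists2 A : V, avdim A = g & frobPoly A = h.

(* Abelian schemes over the rings of integers of p-adic fields with residue
   field F_p. [padic] indexes the fields K and [asch K] consists of the abelian
   schemes over O_K; a homomorphism of abelian schemes is the same thing as a
   homomorphism of their generic fibres (Neron). [lie X] is the Lie algebra of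
   the generic fibre, over \bar K, as a vector space over C via
   \bar Q_p = C, and [periods X] is the kernel of lie X -> A(C), A being the
   generic fibre of X, so that A(C) = lie X / periods X. *)
Record avLifts (R : realType) (p : nat) (V : avFp R p) := AvLifts {
  padic : Type;
  asch : padic -> avCategory;
  sfib : forall K, asch K -> V;
  redm : forall K (X Y : asch K), homQ X Y -> homQ (sfib X) (sfib Y);
  (* the identification of the special fibre of the dual with the dual of the
     special fibre *)
  redD : forall K (X : asch K), homQ (sfib (dual X)) (dual (sfib X));
  lie : forall K, asch K -> vectType R[i];
  dlie : forall K (X Y : asch K), homQ X Y -> lie X -> lie Y;
  periods : forall K (X : asch K), set (lie X);

  redm_linear : forall K (X Y : asch K), linear (@redm K X Y);
  redm_inj : forall K (X Y : asch K), injective (@redm K X Y);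
  redm_id : forall K (X : asch K), redm (idm X) = idm (sfib X);
  redm_comp : forall K (X Y Z : asch K) (f : homQ Y Z) (k : homQ X Y),
    redm (compm f k) = compm (redm f) (redm k);
  isHom_redm : forall K (X Y : asch K) (f : homQ X Y),
    isHom f -> isHom (redm f);
  isHom_redD : forall K (X : asch K), isHom (redD X);
  redD_iso : forall K (X : asch K), exists f, [/\ isHom f,
    compm f (redD X) = idm _ & compm (redD X) f = idm _];
  redD_nat : forall K (X Y : asch K) (f : homQ X Y),
    compm (redD X) (redm (dualm f)) = compm (dualm (redm f)) (redD Y);
  redD_bidual : forall K (X : asch K),
    compm (dualm (redD X)) (bidual (sfib X))
      = compm (redD (dual X)) (redm (bidual X));

  dim_lie : forall K (X : asch K),
    \dim (fullv : {vspace lie X}) = avdim (sfib X);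
  dlie_linear : forall K (X Y : asch K) (f : homQ X Y), linear (dlie f);
  dlie_linearm : forall K (X Y : asch K) a (f k : homQ X Y) v,
    dlie (a *: f + k) v = ratr a *: dlie f v + dlie k v;
  dlie_id : forall K (X : asch K) v, dlie (idm X) v = v;
  dlie_comp : forall K (X Y Z : asch K) (f : homQ Y Z) (k : homQ X Y) v,
    dlie (compm f k) v = dlie f (dlie k v);
  dlie_inj : forall K (X Y : asch K) (f : homQ X Y),
    (forall v, dlie f v = 0) -> f = 0;
  periods_lattice : forall K (X : asch K),
    exists s : (2 * avdim (sfib X)).-tuple (lie X),
      @periods K X = [set v | inIntSpan s v] /\
      forall c : 'I_(2 * avdim (sfib X)) -> R,
        \sum_i (c i)%:C%C *: tnth s i = 0 -> forall i, c i = 0;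
  dlie_periods : forall K (X Y : asch K) (f : homQ X Y) v,
    isHom f -> @periods K X v -> @periods K Y (dlie f v)
}.


Arguments asch {R p V} _ _.
Arguments sfib {R p V _ K} _.
Arguments redm {R p V _ K X Y} _.
Arguments redD {R p V _ K} _.
Arguments lie {R p V _ K} _.
Arguments dlie {R p V _ K X Y} _ _.
Arguments periods {R p V _ K} _ _.

Section Functor.
Variables (h : {poly int}) (V : avCategory).
Local Notation L := (Lalg h).

Definition EndL (i : forall A : V, L -> homQ A A) (A : V) : set L :=
  [set x | isHom (i A x)].

Variables (i : forall A : V, L -> homQ A A) (Aw : V)
          (lam : forall B, homQ B Aw).

Definition Gideal (B : V) : set L := [set x | isHom (compm (lam B) (i B x))].

(* [Gmor f x] says that x = G(f). *)
Definition Gmor (B D : V) (f : homQ B D) (x : L) : Prop :=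
  compm (lam D) f = compm (lam B) (i B x).

End Functor.

(* The choices defining the functor G on the full subcategory AV_h(p) of
   objects A with [frobPoly A = h]: the isomorphisms i_A : L -> End(A) (x) Q,
   the variety A_w, and the normalized bases lambda_B. Values of [iotaL] and
   [lam] at objects outside AV_h(p) are never used. *)
Record avhFrame (R : realType) (p : nat) (V : avFp R p) (h : {poly int}) :=
  AvhFrame {
  iotaL : forall A : V, Lalg h -> homQ A A;
  Aw : V;
  lam : forall B : V, homQ B Aw;

  iota_iso : forall A, frobPoly A = h -> bijective (@iotaL A);
  iota_add : forall A, frobPoly A = h ->
    {morph @iotaL A : x y / x + y};
  iota_one : forall A, frobPoly A = h -> iotaL A 1 = idm A;
  iota_mul : forall A, frobPoly A = h ->
    forall x y, iotaL A (x * y) = compm (iotaL A x) (iotaL A y);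
  iota_pi : forall A, frobPoly A = h -> iotaL A 'qX = frob A;

  Aw_h : frobPoly Aw = h;
  Aw_End : EndL iotaL Aw = Rw p (h := h);
  lam_basis : forall B, frobPoly B = h ->
    bijective (fun x => compm (lam B) (iotaL B x));

  Gideal_dual : forall B, frobPoly B = h ->
    Gideal iotaL lam (dual B) = tdual (barS p (Gideal iotaL lam B));
  Gmor_dual : forall B D (f : homQ B D) x,
    frobPoly B = h -> frobPoly D = h -> isHom f ->
    Gmor iotaL lam f x -> Gmor iotaL lam (dualm f) (bar p x);
  Gmor_bidual : forall B, frobPoly B = h ->
    Gmor iotaL lam (bidual B) (- 1)
}.

Arguments iotaL {R p V h}.
Arguments Aw {R p V h}.
Arguments lam {R p V h}.

Section Lifts.
Variables (R : realType) (p : nat) (h : {poly int}) (g : nat).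
Variables (V : avFp R p) (M : avLifts V) (F : avhFrame V h).
Local Notation L := (Lalg h).
Local Notation HomLC := {rmorphism L -> R[i]}.
Implicit Types (S : set L) (Phi : set HomLC).

Definition enumerates (phi : 'I_g -> HomLC) Phi : Prop :=
  injective phi /\ range phi = Phi.

Definition embed (phi : 'I_g -> HomLC) (x : L) : 'rV[R[i]]_g :=
  \row_j phi j x.

(* A C-linear isomorphism lie X -> C^g under which each x in L that lifts to
   an endomorphism of X acts through the g homomorphisms phi_j. *)
Definition lie_iso (phi : 'I_g -> HomLC) K (X : asch M K)
    (theta : lie X -> 'rV[R[i]]_g) : Prop :=
  [/\ linear theta, bijective theta
    & forall (f : homQ X X) x, redm f = iotaL F (sfib X) x ->
        forall v, theta (dlie f v) = \row_j (phi j x * theta v 0 j)].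

Definition canonical_lift K (X : asch M K) : Prop :=
  forall f0 : homQ (sfib X) (sfib X), isHom f0 ->
    exists2 f : homQ X X, isHom f & redm f = f0.

Definition has_CM_through Phi K (X : asch M K) : Prop :=
  exists phi (theta : lie X -> 'rV[R[i]]_g),
    enumerates phi Phi /\ lie_iso phi theta.

(* The special fibre of X is in AV_h(p), has endomorphism ring S, and X is a
   canonical lifting of it with CM by L through Phi. *)
Definition CM_lift S Phi K (X : asch M K) : Prop :=
  [/\ frobPoly (sfib X) = h, EndL (iotaL F) (sfib X) = S,
      canonical_lift X & has_CM_through Phi X].

Definition SPhi Phi : set (set L) :=
  [set S | [/\ is_order S, Gorenstein S, barS p S = S
             & exists K (X : asch M K), CM_lift S Phi X]].

(* theta induces an isomorphism A(C) = lie X / periods X -> C^g / Phi(J) *)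
Definition uniformizes (phi : 'I_g -> HomLC) K (X : asch M K)
    (theta : lie X -> 'rV[R[i]]_g) (J : set L) : Prop :=
  lie_iso phi theta /\ theta @` periods X = embed phi @` J.

(* f mod p : A_0 -> dual A_0 *)
Definition red_polar K (X : asch M K) (f : homQ X (dual X))
    : homQ (sfib X) (dual (sfib X)) :=
  compm (redD X) (redm f).

(* [Hmor phi theta theta' f y] says that y = H(f). *)
Definition Hmor (phi : 'I_g -> HomLC) K (X : asch M K)
    (theta : lie X -> 'rV[R[i]]_g) (theta' : lie (dual X) -> 'rV[R[i]]_g)
    (f : homQ X (dual X)) (y : L) : Prop :=
  forall v, theta' (dlie f v) = \row_j (phi j y * theta v 0 j).

(* The data attached to S in SPhi Phi that determine alpha: a canonical
   lifting X with CM through Phi, uniformizations of X and its dual, and the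
   comparison of reduction modulo p with the complex description. *)
Record reduction_unit S Phi (alpha : L) := ReductionUnit {
  ru_K : padic M;
  ru_X : asch M ru_K;
  ru_lift : CM_lift S Phi ru_X;
  ru_phi : 'I_g -> HomLC;
  ru_phiP : enumerates ru_phi Phi;
  ru_I : set L;
  ru_I_frac : fractional_ideal (Rw p (h := h)) ru_I;
  ru_theta : lie ru_X -> 'rV[R[i]]_g;
  ru_thetaP : uniformizes ru_phi ru_theta ru_I;
  ru_theta' : lie (dual ru_X) -> 'rV[R[i]]_g;
  ru_theta'P : uniformizes ru_phi ru_theta' (tdual (barS p ru_I));
  ru_G_Hom :
    [set x | exists2 f0 : homQ (sfib ru_X) (dual (sfib ru_X)),
       isHom f0 & Gmor (iotaL F) (lam F) f0 x]
    = colon (tdual (barS p ru_I)) ru_I;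
  ru_alpha : unitsR p S alpha;
  ru_alphaP : forall f : homQ ru_X (dual ru_X), isHom f ->
    exists y, [/\ colon (tdual (barS p ru_I)) ru_I y,
                  Hmor ru_phi ru_theta ru_theta' f y
                & Gmor (iotaL F) (lam F) (red_polar f) (alpha * y)]
}.

End Lifts.

(* Main.v *)
From HB Require Import structures.
Require Import Defs.
From mathcomp Require Import all_boot all_order all_algebra.
From mathcomp Require Import all_classical reals.
From mathcomp Require Import complex.

Set Implicit Arguments.
Unset Strict Implicit.
Unset Printing Implicit Defensive.

Import Order.TTheory GRing.Theory Num.Theory.

Local Open Scope classical_set_scope.
Local Open Scope ring_scope.

(** Everything rests on two remarks about the condition cutting out the sets
    P_Phi(I), namely that x be totally imaginary and Phi-positive.

    - Multiplying x by a real unit u keeps x totally imaginary and moves the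
      sign condition from Phi_c to Phi_(u c) ([positive_twist]). Hence
      P^alpha_(Phi_b)(I) is literally P^1_(Phi_(alpha b))(I) ([Pset_twist]),
      and more generally P^1_(Phi_(u c))(I) is the set P^u_(Phi_c)(I). All the
      bijections wanted are therefore between sets P^u_Phi(I) and P^1_Phi(I)
      for one and the same CM-type Phi.
    - Multiplying x by a totally positive unit of L changes neither condition,
      and every element of <v * bar v> is totally positive, since a
      homomorphism f : L -> C sends v * bar v to |f(v)|^2
      ([normgrp_Lplus]).

    If xi is a real unit and t = xi * l is in T^* with l totally positive,
    division by t permutes the classes of T^* / <v * bar v>, hence the
    transversal. Along this permutation xi^-1 * i0 * u changes by a totally
    positive factor only, so it induces a bijection between P^xi_Phi(I) and
    P^1_Phi(I) ([Pset_bijection]). The implication from st2 to st3 takes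
    xi = alpha, and that from st1 to st4 takes l = 1. For st1 implies st2, the
    unit xi lies in T^*, so it has a representative in the transversal, and
    their quotient is in <v * bar v>. Since P^alpha_(Phi_b) = P^1_(Phi_(alpha b))
    and Phi_(alpha b) is in the orbit of Phi_b, st4 gives st5 by composing two
    bijections, and st3 is the case of st5 at the orbit point Phi_b itself.

    The remaining work is to see that bar is an involutive ring automorphism
    which every f : L -> C turns into complex conjugation
    ([bar_CM_involution]). For it to be multiplicative, p / pi has to be a root
    of h. This comes from duality of abelian varieties: through
    L = End(A^v) (x) Q, the element p / pi is the dual of the Frobenius of A, so
    it satisfies the same polynomial as that Frobenius. Conjugation then appears
    because f(pi) has absolute value sqrt p, so f(p / pi) is the conjugate of
    f(pi). *)

(** * The algebra Q[x]/(h) *)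

Section QuotientAlgebra.

Variable h : {poly int}.
Hypotheses (h_monic : h \is monic) (h_gt1 : (1 < size h)%N).
Local Notation L := (Lalg h).
Local Notation hQ := (map_poly intr h : {poly rat}).

Lemma mk_monic_intr : mk_monic hQ = hQ.
Proof.
by rewrite /mk_monic monic_map // andbT size_map_poly_id0 ?h_gt1 //
  (monicP h_monic) oner_eq0.
Qed.

Lemma in_qpoly_horner (r : {poly rat}) : in_qpoly hQ r = horner_alg 'qX r.
Proof.
elim/poly_ind: r => [|r c IHr]; first by rewrite in_qpoly0 rmorph0.
rewrite in_qpolyD in_qpolyM rmorphD rmorphM /= horner_algX horner_algC IHr.
by rewrite -alg_polyC in_qpolyZ in_qpoly1.
Qed.

Lemma horner_qX (x : L) : horner_alg 'qX (x : {poly rat}) = x.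
Proof.
rewrite -in_qpoly_horner; apply: val_inj => /=.
exact: in_qpoly_small (size_mk_monic x).
Qed.

Lemma horner_qX_root : horner_alg ('qX : L) hQ = 0.
Proof.
rewrite -in_qpoly_horner; apply: val_inj => /=.
by rewrite mk_monic_intr Pdiv.RingMonic.rmodpp // monic_map.
Qed.

(** The universal property of Q[x]/(h): evaluation at a root z of h in L depends
    only on the class modulo h. At z = p / pi, it makes bar multiplicative. *)
Lemma horner_alg_in_qpoly (z : L) (r : {poly rat}) : horner_alg z hQ = 0 ->
  horner_alg z (in_qpoly hQ r : {poly rat}) = horner_alg z r.
Proof.
move=> hz; rewrite /= mk_monic_intr.
have hQ_monic : hQ \is monic by rewrite monic_map.
rewrite [in RHS](Pdiv.RingMonic.rdivp_eq hQ_monic r).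
by rewrite rmorphD rmorphM /= hz mulr0 add0r.
Qed.

End QuotientAlgebra.

(** * The dual of Frobenius as a root of h *)

Lemma linear_combination (U W : lmodType rat) (f : U -> W) : linear f ->
  forall n (c : 'I_n -> rat) (u : 'I_n -> U),
    f (\sum_i c i *: u i) = \sum_i c i *: f (u i).
Proof.
move=> f_lin n c u.
pose fL : {linear U -> W} := HB.pack f (GRing.isLinear.Build _ _ _ _ _ f_lin).
rewrite -[f]/(fL : U -> W) linear_sum.
by apply: eq_bigr => i _; rewrite linearZ.
Qed.

Section Frobenius.

Variables (R : realType) (p : nat) (h : {poly int}).
Variables (V : avFp R p) (F : avhFrame V h) (A : V).
Hypothesis hA : frobPoly A = h.
Local Notation L := (Lalg h).
Local Notation hQ := (map_poly intr h : {poly rat}).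

Let hB : frobPoly (dual A) = h. Proof. by rewrite frobPoly_dual. Qed.
Let h_monic : h \is monic. Proof. by rewrite -hA frobPoly_monic. Qed.

Lemma iotaL_inj (B : V) : frobPoly B = h -> injective (iotaL F B).
Proof. by move=> Bh; apply: bij_inj (iota_iso F Bh). Qed.

Lemma iotaL_zmod (B : V) : frobPoly B = h -> zmod_morphism (iotaL F B).
Proof.
move=> Bh x y; apply/eqP; rewrite eq_sym subr_eq -(iota_add F Bh).
by rewrite subrK.
Qed.

Lemma iotaL_scale (B : V) : frobPoly B = h -> scalable (iotaL F B).
Proof. by move=> Bh; apply: rat_linear; apply: iotaL_zmod. Qed.

Lemma iotaL0 (B : V) : frobPoly B = h -> iotaL F B 0 = 0.
Proof. by move=> Bh; rewrite -(subrr 0) (iotaL_zmod Bh) subrr. Qed.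

Lemma iotaL_linear (B : V) : frobPoly B = h -> linear (iotaL F B).
Proof. by move=> Bh a x y; rewrite iota_add // iotaL_scale. Qed.

(** The element z of L acting on A^v as the dual of the Frobenius of A. Its
    product with pi is p, Frobenius times Verschiebung, and h(z) = 0 is the dual of the
    relation h(Frob_A) = 0. The first equation is what makes pi invertible, so
    that z is p / pi. *)
Lemma verschiebung_root :
  exists z : L, 'qX * z = p%:R /\ horner_alg z hQ = 0.
Proof.
have [iV VK KV] := iota_iso F hB.
exists (iV (dualm (frob A))); set z := iV _.
have iz : iotaL F (dual A) z = dualm (frob A) by rewrite /z KV.
split; apply: (iotaL_inj hB).
  rewrite iota_mul // iz iota_pi // frob_dual -(iota_one F hB).
  by rewrite -iotaL_scale // scaler_nat.
(* Duality reverses composition, so powers of z correspond to duals of powers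
   of the Frobenius. *)
have izX n : iotaL F (dual A) (z ^+ n)
    = dualm (iter n (compm (frob A)) (idm A)).
  elim: n => [|n IHn]; first by rewrite /= expr0 iota_one // dualm_id.
  by rewrite exprSr iota_mul // IHn iz /= dualm_comp.
rewrite iotaL0 // -(_ : dualm 0 = 0); last first.
  by have := dualm_linear (- 1) (0 : homQ A A) 0;
    rewrite scaler0 addr0 scaleN1r addNr.
rewrite -(frobPoly_frob A) hA (linear_combination (@dualm_linear _ _ _)).
have -> : horner_alg z hQ = \sum_(i < size h) (h`_i)%:~R *: z ^+ i.
  rewrite /horner_alg /horner_morph horner_coef size_map_poly.
  rewrite size_map_poly_id0 ?(monicP h_monic) ?oner_eq0 //.
  by apply: eq_bigr => i _; rewrite !coef_map /= mulr_algl.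
rewrite (linear_combination (iotaL_linear hB)).
by apply: eq_bigr => i _; rewrite izX.
Qed.

Hypothesis p_gt0 : (0 < p)%N.

Lemma natr_unit : (p%:R : L) \is a GRing.unit.
Proof.
have : (in_alg L) p%:R \is a GRing.unit.
  by rewrite rmorph_unit // unitfE pnatr_eq0 -lt0n.
by rewrite rmorph_nat.
Qed.

Lemma qX_unit : ('qX : L) \is a GRing.unit.
Proof.
have [z [pz _]] := verschiebung_root.
by apply/unitrPr; exists (z / p%:R); rewrite mulrA pz mulrV // natr_unit.
Qed.

Lemma p_div_qX_root : horner_alg (p%:R / 'qX : L) hQ = 0.
Proof.
have [z [pz hz]] := verschiebung_root.
by rewrite -pz mulrAC mulrV ?mul1r // qX_unit.
Qed.

End Frobenius.

(** * The canonical involution *)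

(** What makes signs of imaginary parts behave under multiplication: bar is a
    multiplicative involution that every homomorphism to C turns into complex
    conjugation. The comparison of the sets P_Phi(I) rests on this alone. *)
Record CM_involution (R : realType) (p : nat) (h : {poly int}) : Prop :=
  CMInvolution {
  bar1 : bar p (1 : Lalg h) = 1;
  barM : {morph @bar p h : x y / x * y};
  barK : involutive (@bar p h);
  bar_conj : forall (f : {rmorphism Lalg h -> R[i]}) x, f (bar p x) = (f x)^*
}.

Section BarInvolution.

Variables (R : realType) (p : nat) (h : {poly int}).
Variables (V : avFp R p) (F : avhFrame V h) (A : V).
Hypotheses (hA : frobPoly A = h) (h_gt1 : (1 < size h)%N) (p_gt0 : (0 < p)%N).
Local Notation L := (Lalg h).
Local Notation hQ := (map_poly intr h : {poly rat}).
Local Notation z := (p%:R / 'qX : L).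

Let h_monic : h \is monic. Proof. by rewrite -hA frobPoly_monic. Qed.

Lemma bar_in_qpoly (r : {poly rat}) : bar p (in_qpoly hQ r) = horner_alg z r.
Proof. by apply: horner_alg_in_qpoly => //; apply: (p_div_qX_root F hA). Qed.

Lemma barM_frob : {morph @bar p h : x y / x * y}.
Proof.
move=> x y; rewrite -[x * y]/(in_qpoly hQ ((x : {poly rat}) * y)).
by rewrite bar_in_qpoly rmorphM.
Qed.

Lemma bar1_frob : bar p (1 : L) = 1.
Proof. by rewrite -[X in bar p X](in_qpoly1 hQ) bar_in_qpoly rmorph1. Qed.

Lemma bar_qX : bar p ('qX : L) = z.
Proof. by rewrite bar_in_qpoly horner_algX. Qed.

Lemma bar_p_div_qX : bar p z = 'qX.
Proof.
have uX := qX_unit F hA p_gt0; have up := natr_unit h p_gt0.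
have uz : z \is a GRing.unit by rewrite unitrMl ?unitrV.
apply: (mulrI uz); rewrite -{1}bar_qX -barM_frob mulrCA mulrV // mulr1.
by rewrite divrK // /bar qpolyC_natr rmorph_nat.
Qed.

Lemma bar_horner (a : L) (r : {poly rat}) :
  bar p (horner_alg a r) = horner_alg (bar p a) r.
Proof.
have barD : {morph @bar p h : x y / x + y} by move=> x y; rewrite /bar rmorphD.
have bar0 : bar p (0 : L) = 0 by rewrite /bar rmorph0.
elim/poly_ind: r => [|r c IHr]; first by rewrite !rmorph0.
rewrite !rmorphD !rmorphM /= !horner_algX !horner_algC barD barM_frob IHr.
congr (_ + _); rewrite -[in LHS]in_qpoly1 -in_qpolyZ bar_in_qpoly.
by rewrite alg_polyC horner_algC.
Qed.

(** Since bar is a homomorphism, bar (bar x) is x with pi replaced by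
    p / (p / pi). *)
Lemma barK_frob : involutive (@bar p h).
Proof.
move=> x; rewrite [in LHS](_ : bar p x = horner_alg z (x : {poly rat})) //.
by rewrite bar_horner bar_p_div_qX horner_qX.
Qed.

Lemma rmorph_horner_alg (K : numFieldType) (f : {rmorphism L -> K})
    (a : L) (r : {poly rat}) :
  f (horner_alg a r) = (map_poly ratr r).[f a].
Proof.
elim/poly_ind: r => [|r c IHr]; first by rewrite !rmorph0 horner0.
rewrite !rmorphD !rmorphM /= horner_algX horner_algC hornerD hornerM -IHr.
rewrite map_polyX map_polyC hornerX hornerC; congr (_ + _).
by rewrite -[LHS]/((f \o in_alg L) c) fmorph_eq_rat.
Qed.

(** Both sides are ring homomorphisms in x, so it suffices to compare them at
    pi, where Weil's f(pi) * conj f(pi) = p gives the equality. *)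
Lemma bar_conj_frob (f : {rmorphism L -> R[i]}) (x : L) :
  f (bar p x) = (f x)^*.
Proof.
have fX0 : f 'qX != 0 by rewrite -unitfE rmorph_unit // (qX_unit F hA).
have fX : f 'qX * (f 'qX)^* = p%:R.
  apply: (frobPoly_weil (A := A)); rewrite hA /root.
  have /(congr1 f) := horner_qX_root h_monic h_gt1.
  rewrite rmorph_horner_alg rmorph0 -map_poly_comp => h0.
  apply/eqP; rewrite -h0; congr (_.[_]).
  by apply: eq_map_poly => n /=; rewrite ratr_int.
have fz : f z = (f 'qX)^*.
  rewrite rmorphM rmorph_nat -fX rmorphV ?(qX_unit F hA) //.
  by rewrite mulrAC divff ?mul1r.
rewrite /bar rmorph_horner_alg fz -[x in RHS]horner_qX rmorph_horner_alg.
rewrite -horner_map -map_poly_comp; congr (_.[_]).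
apply: eq_map_poly => c; apply: esym.
exact: (fmorph_eq_rat (Num.conj \o ratr : {rmorphism rat -> R[i]})).
Qed.

Lemma bar_CM_involution : CM_involution R p h.
Proof.
split; [exact: bar1_frob | exact: barM_frob | exact: barK_frob |].
exact: bar_conj_frob.
Qed.

End BarInvolution.

(** * Bijections and imaginary parts *)

Section InBijection.

Variable X : Type.
Implicit Types A B D : set X.

Lemma in_bijection_trans A B D :
  in_bijection A B -> in_bijection B D -> in_bijection A D.
Proof.
by move=> [f bf] [k bk]; exists (k \o f); apply: set_bij_comp bf bk.
Qed.

Lemma in_bijection_sym A B : in_bijection A B -> in_bijection B A.
Proof.
move=> [f [fAB f_inj f_surj]].
have /choice[k kP] : forall y, exists x, B y -> A x /\ f x = y.
  move=> y; have [/f_surj[x Ax fx]|nBy] := pselect (B y); first by exists x.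
  by exists y.
exists k; split=> [y /kP[]//|y1 y2|x Ax].
  by rewrite !inE => /kP[_ e1] /kP[_ e2] ek; rewrite -e1 ek e2.
have [Akf fkf] := kP _ (fAB _ Ax).
by exists (f x); [exact: fAB | apply: f_inj; rewrite ?inE].
Qed.

End InBijection.

Lemma Im_conj (R : realType) (z : R[i]) : complex.Im z^* = - complex.Im z.
Proof. by case: z. Qed.

Lemma Im_mul_real (R : realType) (z w : R[i]) :
  z^* = z -> complex.Im (z * w) = complex.Re z * complex.Im w.
Proof.
case: z w => [a b] [c d] /(congr1 (@complex.Im R)); rewrite Im_conj /= => /eqP.
rewrite eq_sym -addr_eq0 -mulr2n mulrn_eq0 /= => /eqP ->.
by rewrite mul0r addr0.
Qed.

(** * Total positivity and norms *)

Lemma divr_cancel (A : comUnitRingType) (x y a : A) :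
  y \is a GRing.unit -> a \is a GRing.unit -> (x * a) / (y * a) = x / y.
Proof. by move=> yu au; rewrite invrM // mulrA mulrK. Qed.

Section NormGroup.

Variables (p : nat) (h : {poly int}) (T : set (Lalg h)).

Lemma normgrp1 : normgrp p T 1.
Proof. by []. Qed.

Lemma normgrp_div x y : normgrp p T x -> normgrp p T y -> normgrp p T (x / y).
Proof. by move=> Nx Ny H H1 HV HN; apply: (HV); [apply: Nx | apply: Ny]. Qed.

End NormGroup.

Section Positivity.

Variables (R : realType) (p : nat) (h : {poly int}).
Hypothesis CM : CM_involution R p h.
Local Notation L := (Lalg h).
Implicit Types (x y u v c l : L) (T : set L).

Lemma bar_unit u : u \is a GRing.unit -> bar p u \is a GRing.unit.
Proof.
move=> uu; apply/unitrPr; exists (bar p u^-1).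
by rewrite -(barM CM) mulrV // (bar1 CM).
Qed.

Lemma barV u : u \is a GRing.unit -> bar p u^-1 = (bar p u)^-1.
Proof.
move=> uu; apply: (mulrI (bar_unit uu)).
by rewrite -(barM CM) !mulrV ?(bar1 CM) // bar_unit.
Qed.

Lemma LR_inv u : u \is a GRing.unit -> LR p u -> LR p u^-1.
Proof. by move=> uu uR; rewrite /LR /= barV // uR. Qed.

(** Invertibility is required along with total positivity so that these
    elements visibly form a group, to which the group <v * bar v> can be
    compared. *)
Definition Lplus_units : set L := [set l | Lplus p R l /\ l \is a GRing.unit].

Lemma Lplus_units1 : Lplus_units 1.
Proof.
by split; [split=> [|f]; [exact: bar1 CM | rewrite rmorph1]|rewrite unitr1].
Qed.

Lemma Lplus_units_div x y :
  Lplus_units x -> Lplus_units y -> Lplus_units (x / y).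
Proof.
move=> [[xR x_gt0] xu] [[yR y_gt0] yu]; split; last by rewrite unitrMl ?unitrV.
split=> [|f]; first by rewrite /LR /= (barM CM) xR barV // yR.
by rewrite rmorphM rmorphV //= divr_gt0.
Qed.

Lemma Lplus_unitsV x : Lplus_units x -> Lplus_units x^-1.
Proof. by rewrite -[x^-1]mul1r; apply: Lplus_units_div Lplus_units1. Qed.

Lemma Lplus_unitsM x y : Lplus_units x -> Lplus_units y -> Lplus_units (x * y).
Proof.
by move=> Lx Ly; rewrite -[y]invrK; apply: Lplus_units_div (Lplus_unitsV Ly).
Qed.

Lemma Lplus_norm v : v \is a GRing.unit -> Lplus_units (v * bar p v).
Proof.
move=> vu; split; last by rewrite unitrMl ?bar_unit.
split=> [|f]; first by rewrite /LR /= (barM CM) (barK CM) mulrC.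
by rewrite rmorphM /= (bar_conj CM) mul_conjC_gt0 -unitfE rmorph_unit.
Qed.

Lemma normgrp_Lplus T x : normgrp p T x -> Lplus_units x.
Proof.
apply; [exact: Lplus_units1 | exact: Lplus_units_div |].
by move=> v [vu _ _]; apply: Lplus_norm.
Qed.

Lemma totally_imaginaryM u x :
  LR p u -> totally_imaginary p x -> totally_imaginary p (u * x).
Proof. by move=> uR xI; rewrite /totally_imaginary (barM CM) uR xI mulrN. Qed.

Lemma positive_Lplus (Phi : set {rmorphism L -> R[i]}) l x :
  Lplus p R l -> positive Phi x -> positive Phi (l * x).
Proof.
move=> [_ l_gt0] x_gt0 f Pf.
have := l_gt0 f; rewrite ltcE /= => /andP[/eqP l0 lr].
rewrite rmorphM /= Im_mul_real; first by rewrite mulr_gt0 // x_gt0.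
exact/CrealP/gtr0_real.
Qed.

(** The sign of Im f(c) and that of Im f(x) are both multiplied by the sign of
    the real number f(u). When f(u) < 0, the hypothesis is used at the conjugate
    of f, which lies in Phi_c exactly when f lies in Phi_(u c). *)
Lemma positive_twist u c x : LR p u ->
  positive (Phi_of R c) x -> positive (Phi_of R (u * c)) (u * x).
Proof.
move=> uR x_gt0 f.
have fuR : (f u)^* = f u by rewrite -(bar_conj CM) uR.
rewrite /Phi_of /= !rmorphM /= !(Im_mul_real _ fuR).
have [fu0|fu0|->] := ltgtP (complex.Re (f u)) 0; last by rewrite !mul0r ltxx.
- rewrite !nmulr_rgt0 // => fc0.
  have := x_gt0 (Num.conj \o f : {rmorphism L -> R[i]}).
  by rewrite /Phi_of /= !Im_conj !oppr_gt0; apply.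
- by rewrite !pmulr_rgt0 // => /x_gt0.
Qed.

(** * Comparison of the sets P_Phi(I) *)

(** Multiplication by alpha and by alpha^-1 exchange the two sign conditions,
    so the sets coincide and no bijection has to be chosen. *)
Lemma Pset_twist (Tr : set L) i0 alpha c (I : set L) :
  alpha \is a GRing.unit -> LR p alpha ->
  Pset p Tr i0 alpha (Phi_of R c) I = Pset p Tr i0 1 (Phi_of R (alpha * c)) I.
Proof.
move=> au aR; have aVR := LR_inv au aR.
apply/seteqP.
split=> x [Iex [u [Tu xE xI x_pos]]]; split=> //; exists u; split=> //.
- by rewrite invr1 mul1r -(mulVKr au x); apply: totally_imaginaryM.
- by rewrite invr1 mul1r -(mulVKr au x); apply: positive_twist.
- by apply: totally_imaginaryM => //; rewrite invr1 mul1r in xI.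
- rewrite -(mulKr au c); apply: positive_twist => //.
  by rewrite invr1 mul1r in x_pos.
Qed.

Lemma unitsS_div T : (forall x y, T x -> T y -> T (x * y)) ->
  forall x y, unitsS T x -> unitsS T y -> unitsS T (x / y).
Proof.
move=> TM x y [xu Tx TVx] [yu Ty TVy].
split; [by rewrite unitrMl ?unitrV | exact: TM |].
by rewrite invrM ?unitrV // invrK; apply: TM.
Qed.

(** Division by t acts on T^* / <v * bar v> by a translation, and s is the
    permutation of the representatives that it induces. What matters about the
    classes is only that s u and u / t differ by a totally positive unit. *)
Lemma transversal_translate T (Tr : set L) t :
  (forall x y, T x -> T y -> T (x * y)) -> unit_transversal p T Tr ->
  unitsS T t ->
  exists2 s : L -> L, set_bij Tr Tr s
    & forall u, Tr u -> Lplus_units (u / t / s u).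
Proof.
move=> TM [TrT TrP] Tt; have Tdiv := unitsS_div TM.
have tu : t \is a GRing.unit by case: Tt.
have Tr_unit u : Tr u -> u \is a GRing.unit by case/TrT.
have Tr_uniq x u w : unitsS T x -> Tr u -> Tr w ->
    normgrp p T (x / u) -> normgrp p T (x / w) -> u = w.
  move=> Tx Tu Tw xu xw; have [r [_ rP]] := TrP x Tx.
  by rewrite -(rP u) // -(rP w).
have Tut u : Tr u -> unitsS T (u / t) by move=> /TrT Tu; apply: Tdiv.
have /choice[s sP] : forall u, exists w,
    Tr u -> Tr w /\ normgrp p T (u / t / w).
  move=> u; have [/Tut/TrP[w [wP _]]|nTu] := pselect (Tr u); first by exists w.
  by exists u.
exists s; last by move=> u /sP[_ /normgrp_Lplus].
split=> [u /sP[]//|u1 u2|w Tw].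
- rewrite !inE => Tu1 Tu2 es; have [Ts1 N1] := sP _ Tu1.
  have [_ N2] := sP _ Tu2; rewrite -es in N2.
  have := normgrp_div N1 N2.
  have u2u := Tr_unit _ Tu2; have s1u := Tr_unit _ Ts1.
  rewrite divr_cancel ?unitrV ?unitrMl ?unitrV // divr_cancel ?unitrV // => N12.
  apply: (Tr_uniq u1) => //; first exact: TrT.
  by rewrite mulrV ?Tr_unit //; apply: normgrp1.
- (* The preimage of w is the representative of the class of w * t. *)
  have Twt : unitsS T (w * t).
    have Tt1 : unitsS T t^-1 by case: Tt; split; rewrite ?unitrV ?invrK.
    by rewrite -[t]invrK; apply: (Tdiv _ _ (TrT _ Tw)).
  have [u [[Tu Nu] _]] := TrP _ Twt.
  exists u => //; have [Ts Ns] := sP u Tu.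
  apply: (Tr_uniq (u / t)) => //; first exact: Tut.
  have := normgrp_div (@normgrp1 p h T) Nu.
  have uu := Tr_unit _ Tu; have wu := Tr_unit _ Tw.
  by rewrite mul1r invrM ?unitrV ?unitrMl // invrK invrM // mulrA.
Qed.

(** The point x = i0 * u is sent to i0 * s u, with s the translation by
    t = xi * l. As s u = u / (t * m) with m totally positive, xi^-1 * x and the
    image of x agree up to the totally positive unit l * m. *)
Lemma Pset_bijection (I Tr : set L) i0 xi l (Phi : set {rmorphism L -> R[i]}) :
  unit_transversal p (colon I I) Tr ->
  ((exists i, autodual p I i) -> autodual p I i0) ->
  xi \is a GRing.unit -> LR p xi -> Lplus_units l ->
  unitsS (colon I I) (xi * l) ->
  in_bijection (Pset p Tr i0 xi Phi I) (Pset p Tr i0 1 Phi I).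
Proof.
move=> TrP i0P xiu xiR Ll Tt.
have [Iex|Inex] := pselect (exists i, autodual p I i); last first.
  by exists id; split=> [x []|x y|x []]//; rewrite inE => -[].
have [i0u _] := i0P Iex.
have TM x y : colon I I x -> colon I I y -> colon I I (x * y).
  by move=> Tx Ty z Iz; rewrite -mulrA; apply/Tx/Ty.
have Tr_unit u : Tr u -> u \is a GRing.unit by case: TrP => TrT _ /TrT[].
have [s [s_fun s_inj s_surj] sP] := transversal_translate TM TrP Tt.
have goodM m (x y : L) : Lplus_units m -> y = m * x ->
    totally_imaginary p x /\ positive Phi x ->
    totally_imaginary p y /\ positive Phi y.
  move=> [Lm _] -> [xI xP].
  by split; [apply: totally_imaginaryM => //; case: Lm | apply: positive_Lplus].
have s_good u : Tr u ->
    (totally_imaginary p (xi^-1 * (i0 * u)) /\ positive Phi (xi^-1 * (i0 * u)))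
    <-> (totally_imaginary p (i0 * s u) /\ positive Phi (i0 * s u)).
  move=> Tu; have Lm := sP u Tu; set m := _ / _ in Lm.
  have Llm := Lplus_unitsM Ll Lm.
  have e : xi^-1 * (i0 * u) = (l * m) * (i0 * s u).
    have ms : m * s u = u / (xi * l) by rewrite divrK //; apply/Tr_unit/s_fun.
    rewrite [LHS]mulrC mulrACA ms invrM ?(proj2 Ll) //.
    rewrite [u * _]mulrA mulrA [u / l]mulrC.
    by rewrite mulrACA mulrV ?(proj2 Ll) // mul1r.
  split; last exact: goodM Llm e.
  apply: (goodM _ _ _ (Lplus_unitsV Llm)).
  by rewrite e mulKr //; case: Llm.
exists (fun x => i0 * s (i0^-1 * x)); split.
- move=> _ [_ [u [Tu -> uI uP]]]; rewrite mulKr //; split=> //.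
  have [sI sPos] := (s_good u Tu).1 (conj uI uP).
  by exists (s u); rewrite invr1 mul1r; split=> //; apply: s_fun.
- move=> x y; rewrite !inE => -[_ [u [Tu -> _ _]]] [_ [w [Tw -> _ _]]].
  by rewrite !mulKr // => /(mulrI i0u)/s_inj ->; rewrite ?inE.
- move=> _ [_ [w [/s_surj[u Tu <-] -> sI sPos]]].
  rewrite invr1 mul1r in sI sPos.
  have [uI uP] := (s_good u Tu).2 (conj sI sPos).
  exists (i0 * u); last by rewrite mulKr.
  by split=> //; exists u.
Qed.

End Positivity.

(** * The implications *)

Theorem theorem5p5 (R : realType) (p : nat) (h : {poly int}) (g : nat)
    (V : avFp R p) (M : avLifts V) (F : avhFrame V h)
    (p_prime : prime p)
    (h_weil : weil_polynomial V h g)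
    (h_sqf : squarefree_poly h)
    (h_noreal : forall x : R, ~~ root (map_poly intr h) x)
    (b : Lalg h)
    (b_unit : b \is a GRing.unit) (b_imag : totally_imaginary p b)
    (Phib_CM : is_CMtype g (Phi_of R b))
    (S : set (Lalg h)) (S_in : SPhi g M F (Phi_of R b) S)
    (alpha : Lalg h) (alphaP : reduction_unit g M F S (Phi_of R b) alpha)
    (I : set (Lalg h)) (I_frac : fractional_ideal (Rw p (h := h)) I)
    (Tr : set (Lalg h)) (TrP : unit_transversal p (colon I I) Tr)
    (i0 : Lalg h)
    (i0P : (exists i, autodual p I i) -> autodual p I i0) :
  let T := colon I I in
  let Palpha Phi := Pset p Tr i0 alpha Phi I in
  let P1 Phi := Pset p Tr i0 1 Phi I in
  let st1 := unitsR p S `<=` unitsR p T in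
  let st2 := forall xi, unitsR p S xi ->
    [set xi * l | l in Lplus p R] `&` Tr !=set0 in
  let st3 := in_bijection (Palpha (Phi_of R b)) (P1 (Phi_of R b)) in
  let st4 := forall Phid, CM_orbit p S (Phi_of R b) Phid ->
    in_bijection (P1 (Phi_of R b)) (P1 Phid) in
  let st5 := forall Phid, CM_orbit p S (Phi_of R b) Phid ->
    in_bijection (Palpha (Phi_of R b)) (P1 Phid) in
  [/\ st1 -> st2, st1 -> st4, st2 -> st3, st4 -> st5 & st5 -> st3].
Proof.
move=> T Palpha P1 st1 st2 st3 st4 st5.
have CM : CM_involution R p h.
  have [g_gt0 [A dimA hA]] := h_weil.
  apply: (bar_CM_involution F hA); last exact: prime_gt0.
  by rewrite -hA size_frobPoly dimA; case: (g) g_gt0.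
have [[au Sa SaV] aR] := ru_alpha alphaP.
have PalphaE : Palpha (Phi_of R b) = P1 (Phi_of R (alpha * b)).
  exact: Pset_twist.
have S1 : unitsR p S 1.
  have [[[S1 _ _] _ _] _ _ _] := S_in.
  by split; [split; rewrite ?invr1 ?unitr1 | exact: bar1 CM].
split.
- move=> RST xi Sxi; have [Txi xiR] := RST _ Sxi.
  have xiu : xi \is a GRing.unit by case: Txi.
  have [u [[Tu Nu] _]] := TrP.2 _ Txi.
  have uu : u \is a GRing.unit by case: (TrP.1 _ Tu).
  exists u; split=> //; exists (xi / u)^-1.
    by have [] := Lplus_unitsV CM (normgrp_Lplus CM Nu).
  by rewrite invrM ?unitrV // invrK mulrCA mulrV ?mulr1.
- move=> RST Phid [u [c [Su cu cI -> ->]]].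
  have [Tu uR] := RST _ Su; have uu : u \is a GRing.unit by case: Tu.
  rewrite /P1 -(Pset_twist CM) //. apply: in_bijection_sym.
  apply: (Pset_bijection CM _ TrP i0P uu uR (l := 1)).
    exact: Lplus_units1.
  by rewrite mulr1.
- move=> RST; have [|_ [[l Ll <-] Tt]] := RST alpha; first by split.
  have Tal := TrP.1 _ Tt.
  apply: (Pset_bijection CM _ TrP i0P au aR (l := l)) => //.
  by split=> //; case: Tal => alu _ _; rewrite unitrMr in alu.
- move=> P4 Phid Pd; rewrite PalphaE.
  apply: in_bijection_trans (P4 _ Pd); apply: in_bijection_sym; apply: P4.
  by exists alpha, b; split.
- by apply; exists 1, b; split; rewrite ?mul1r.
Qed.
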